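(* Let $\boldsymbol{k}$ be an algebraically closed field of characteristic other than $2$, let $R=\boldsymbol{k}[x_0,\ldots,x_n]$, and let $\boldsymbol{E}$ and $\boldsymbol{G}$ be finitely generated graded $R$-modules such that $\boldsymbol{E}$ is $m$-linearly presented up to order $1$ and $\boldsymbol{G}$ is $m$-linearly presented up to order $2$. Let $$\cdots \to E^2\xrightarrow{e_2} E^1 \xrightarrow{e_1} E^0 \xrightarrow{e_0} \boldsymbol{E}\to 0,\qquad \cdots \to G^2\xrightarrow{g_2} G^1 \xrightarrow{g_1} G^0 \xrightarrow{g_0} \boldsymbol{G}\to 0$$ be their minimal graded free resolutions. Let $\mu:\boldsymbol{E}\to\boldsymbol{G}$ be a surjective morphism of graded modules and let $\mu^i:E^i\to G^i$ be the maps induced by $\mu$ on the resolutions. Then $\boldsymbol{F}=\ker(\mu)$ is generated in degrees $m$ and $m+1$, and: (i) if $\mu^1$ is surjective, then $\boldsymbol{F}$ is generated in degree $m$ and has linear and quadratic syzygies; furthermore $\beta_{0,m}(\boldsymbol{F})=\beta_{0,m}(\boldsymbol{E})-\beta_{0,m}(\boldsymbol{G})$; (ii) if moreover $\mu^2$ is surjective, then $\boldsymbol{F}$ is linearly presented and $\beta_{1,m+1}(\boldsymbol{F})=\beta_{1,m+1}(\boldsymbol{E})-\beta_{1,m+1}(\boldsymbol{G})$.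
   Context: $R$ has the standard grading. All modules are finitely generated and graded, and morphisms of modules are homogeneous of degree $0$. $\boldsymbol{M}_p$ is the degree $p$ component, $\boldsymbol{M}(q)_p=\boldsymbol{M}_{p+q}$. For a graded module $\boldsymbol{M}$, $\beta_{i,j}(\boldsymbol{M})$ is its graded Betti number, i.e. the $i$-th term of the minimal graded free resolution of $\boldsymbol{M}$ is $\bigoplus_j R(-j)^{\beta_{i,j}(\boldsymbol{M})}$. $\boldsymbol{M}$ is called $m$-linearly presented up to order $k$ if, in its minimal graded free resolution $\cdots\to M^1\to M^0\to\boldsymbol{M}\to 0$, one has $M^i\simeq R(-m-i)^{\beta_{i,m+i}}$ for $0\le i\le k$ (so $\boldsymbol{M}$ is generated in degree $m$ and the first $k$ maps are matrices of linear forms). ''Linearly presented'' means $m$-linearly presented up to order $1$. The maps $\mu^i$ form a morphism of complexes lifting $\mu$; they are determined up to chain homotopy. ''$\boldsymbol{F}$ is generated in degrees $m$ and $m+1$'' means that all its minimal generators have degree $m$ or $m+1$. For a module generated in degree $m$, ''linear and quadratic syzygies'' means that the module of first syzygies of its minimal generators is generated in degrees $m+1$ and $m+2$. *)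

(* Defs.v *)
From Stdlib Require Import ClassicalEpsilon.
From HB Require Import structures.
From mathcomp Require Import all_boot all_order all_algebra.
From mathcomp Require Import mpoly.

Set Implicit Arguments.
Unset Strict Implicit.
Unset Printing Implicit Defensive.

Import Order.TTheory GRing.Theory Num.Theory.
Local Open Scope ring_scope.

(* The degree p part of {mpoly k[n]}, for p : int; it is 0 when p < 0.        *)
Definition mhomog (k : fieldType) (n : nat) (p : int) (f : {mpoly k[n]}) : bool :=
  match p with
  | Posz d => f \is d.-homog
  | Negz _ => f == 0
  end.

Lemma mhomogP (k : fieldType) (n : nat) (p : int) (f : {mpoly k[n]}) :
  reflect (forall u, f@_u != 0 -> p = (mdeg u)%:Z) (mhomog p f).
Proof.
apply: (iffP idP) => [|H].
- case: p => [d|d] /= => [/dhomogP H u|/eqP->] /=; last first.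
    by move=> u; rewrite mcoeff0 eqxx.
  by rewrite -mcoeff_msupp => /H /= ->.
- case: p H => [d|d] H /=.
    by apply/dhomogP => u; rewrite mcoeff_msupp => /H [].
  by apply/eqP/mpolyP => u; rewrite mcoeff0; apply/eqP/negbNE/negP => /H.
Qed.

(* A graded module: an R-module M (R = k[x_0..x_{n-1}] with its standard      *)
(* grading) with subspaces M_p (gr p) such that R_d M_p is contained in       *)
(* M_{p+d} and M is the direct sum of the M_p.                                *)
Record gmodule (k : fieldType) (n : nat) := GModule {
  gm_sort :> lmodType {mpoly k[n]};
  gr : int -> gm_sort -> Prop;
  gr0 : forall p, gr p 0;
  grD : forall p x y, gr p x -> gr p y -> gr p (x + y);
  grZ : forall d p (f : {mpoly k[n]}) x,
    f \is d.-homog -> gr p x -> gr (p + d%:Z) (f *: x);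
  gr_sum : forall x : gm_sort, exists (s : seq int) (c : int -> gm_sort),
    [/\ uniq s, forall p, gr p (c p) & x = \sum_(p <- s) c p];
  gr_direct : forall (s : seq int) (c : int -> gm_sort),
    uniq s -> (forall p, gr p (c p)) -> \sum_(p <- s) c p = 0 ->
    forall p, p \in s -> c p = 0
}.
Arguments gr {k n} M p x : rename.

Record gmor (k : fieldType) (n : nat) (M N : gmodule k n) := GMor {
  gmor_lin :> {linear M -> N};
  gmorP : forall p x, gr M p x -> gr N p (gmor_lin x)
}.

Definition surj (A B : Type) (f : A -> B) : Prop := forall y, exists x, f x = y.

Definition fin_gen (k : fieldType) (n : nat) (M : gmodule k n) : Prop :=
  exists (r : nat) (f : 'I_r -> M), forall x : M,
    exists c : 'I_r -> {mpoly k[n]}, x = \sum_i c i *: f i.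

Section LinearKernel.

Variables (R : pzRingType) (M N : lmodType R) (f : {linear M -> N}).

Definition lker_pred : {pred M} := fun x => f x == 0.

Fact lker_submod_closed : submod_closed lker_pred.
Proof.
split=> [|a u v]; rewrite !unfold_in ?linear0 //.
by move=> /eqP fu /eqP fv; rewrite linearP fu fv scaler0 addr0.
Qed.

HB.instance Definition _ :=
  GRing.isSubmodClosed.Build R M lker_pred lker_submod_closed.

Record lker_type := LkerElt { lker_val : M; _ : lker_val \in lker_pred }.

HB.instance Definition _ := [isSub for lker_val].
HB.instance Definition _ := [Choice of lker_type by <:].
HB.instance Definition _ := [SubChoice_isSubLmodule of lker_type by <:].

Fact lker_val_linear : linear lker_val.
Proof. by []. Qed.

HB.instance Definition _ :=
  GRing.isLinear.Build R lker_type M _ lker_val lker_val_linear.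

Lemma lker_valP (x : lker_type) : f (lker_val x) = 0.
Proof. by apply/eqP; case: x. Qed.

End LinearKernel.

Section Kernel.

Variables (k : fieldType) (n : nat) (M N : gmodule k n) (f : gmor M N).

Let K : lmodType {mpoly k[n]} := lker_type f.

Definition gker_gr (p : int) (x : K) : Prop := gr M p (lker_val x).

Fact gker_gr0 p : gker_gr p 0.
Proof. by rewrite /gker_gr raddf0; apply: gr0. Qed.

Fact gker_grD p x y : gker_gr p x -> gker_gr p y -> gker_gr p (x + y).
Proof. by rewrite /gker_gr raddfD; apply: grD. Qed.

Fact gker_grZ d p (a : {mpoly k[n]}) x :
  a \is d.-homog -> gker_gr p x -> gker_gr (p + d%:Z) (a *: x).
Proof. by rewrite /gker_gr linearZ; apply: grZ. Qed.

Fact gker_gr_sum (x : K) : exists (s : seq int) (c : int -> K),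
  [/\ uniq s, forall p, gker_gr p (c p) & x = \sum_(p <- s) c p].
Proof.
have [s [c [us hc xE]]] := gr_sum (lker_val x).
have fc0 : forall p, p \in s -> f (c p) = 0.
  apply: (@gr_direct _ _ N s (fun p => f (c p))) => // [p|].
    exact/gmorP/hc.
  by rewrite -raddf_sum -xE; apply: (lker_valP x).
exists s, (fun p => insubd (0 : K) (if p \in s then c p else 0)).
have valE p : lker_val (insubd (0 : K) (if p \in s then c p else 0))
            = if p \in s then c p else 0.
  apply: (insubdK (0 : K)); rewrite unfold_in.
  by case: ifP => [/fc0 fc|_]; apply/eqP; rewrite ?linear0.
split=> // [p|].
  by rewrite /gker_gr valE; case: ifP => // _; apply: gr0.
apply: val_inj; rewrite /= xE raddf_sum /=.
by apply: eq_big_seq => p ps; rewrite valE ps.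
Qed.

Fact gker_gr_direct (s : seq int) (c : int -> K) :
  uniq s -> (forall p, gker_gr p (c p)) -> \sum_(p <- s) c p = 0 ->
  forall p, p \in s -> c p = 0.
Proof.
move=> us hc c0 p ps; apply: val_inj; transitivity (0 : M) => //.
apply: (@gr_direct _ _ M s (fun p => lker_val (c p))) => //.
by rewrite -raddf_sum c0 raddf0.
Qed.

Definition gker : gmodule k n :=
  GModule gker_gr0 gker_grD gker_grZ gker_gr_sum gker_gr_direct.

End Kernel.

Section GradedFree.

Variables (k : fieldType) (n : nat) (d : seq int).

Let V : lmodType {mpoly k[n]} := 'rV[{mpoly k[n]}]_(size d).

Definition gfree_gr (p : int) (v : V) : Prop :=
  forall i : 'I_(size d), mhomog (p - d`_i) (v 0 i).

Fact gfree_gr0 p : gfree_gr p 0.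
Proof.
by move=> i; apply/mhomogP => u; rewrite mxE mcoeff0 eqxx.
Qed.

Fact gfree_grD p x y : gfree_gr p x -> gfree_gr p y -> gfree_gr p (x + y).
Proof.
move=> hx hy i; apply/mhomogP => u; rewrite mxE mcoeffD.
have [x0|/(mhomogP _ _ (hx i))->//] := eqVneq ((x 0 i)@_u) 0.
by rewrite x0 add0r => /(mhomogP _ _ (hy i)).
Qed.

Fact gfree_grZ e p (a : {mpoly k[n]}) x :
  a \is e.-homog -> gfree_gr p x -> gfree_gr (p + e%:Z) (a *: x).
Proof.
move=> ha hx i; rewrite mxE addrAC.
move: (hx i); case: (p - _) => [q|q] /= hq.
  by rewrite addnC; apply: dhomogM.
by rewrite (eqP hq) mulr0; apply/mhomogP => u; rewrite mcoeff0 eqxx.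
Qed.

Definition gfree_comp (v : V) (p : int) : V :=
  \row_i (match p - d`_i with
          | Posz q => pihomog mdeg q (v 0 i)
          | Negz _ => 0
          end).

Lemma mcoeff_pihomog (q : nat) (f : {mpoly k[n]}) u :
  (pihomog mdeg q f)@_u = if mdeg u == q then f@_u else 0.
Proof.
rewrite pihomogE raddf_sum /= big_mkcond /=.
transitivity (\sum_(w <- msupp f) if w == u then
                (if mdeg u == q then f@_u else 0) else 0).
  apply: eq_bigr => w _; have [->|wu] := eqVneq w u.
    by case: ifP; rewrite ?mcoeff0 ?mcoeffZ ?mcoeffX ?eqxx ?mulr1.
  by case: ifP; rewrite ?mcoeff0 ?mcoeffZ ?mcoeffX ?(negPf wu) ?mulr0.
rewrite -big_mkcond /=.
have [us|us] := boolP (u \in msupp f).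
  rewrite -big_filter (eq_filter (a2 := pred1 u)) // filter_pred1_uniq ?msupp_uniq //.
  by rewrite big_seq1.
rewrite big_seq_cond big1 => [|w /andP[ws /eqP wu]]; last by rewrite -wu ws in us.
by rewrite (memN_msupp_eq0 us) if_same.
Qed.

Lemma mcoeff_gfree_comp (v : V) p i u :
  (gfree_comp v p 0 i)@_u = if p == d`_i + (mdeg u)%:Z then (v 0 i)@_u else 0.
Proof.
have -> : (p == d`_i + (mdeg u)%:Z) = (p - d`_i == (mdeg u)%:Z).
  by rewrite subr_eq addrC.
rewrite mxE; case: (p - _) => [q|q].
  by rewrite mcoeff_pihomog eqz_nat eq_sym.
by rewrite mcoeff0.
Qed.

Fact gfree_gr_sum (x : V) : exists (s : seq int) (c : int -> V),
  [/\ uniq s, forall p, gfree_gr p (c p) & x = \sum_(p <- s) c p].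
Proof.
pose s := undup [seq d`_i + (q : nat)%:Z |
                   i : 'I_(size d) <- enum 'I_(size d), q <- iota 0 (msize (x 0 i))].
exists s, (gfree_comp x); split; first exact: undup_uniq.
  move=> p i; apply/mhomogP => u; rewrite mcoeff_gfree_comp.
  have [-> _|_] := eqVneq p (d`_i + (mdeg u)%:Z); last by rewrite eqxx.
  by rewrite addrAC subrr add0r.
apply/rowP => i; apply/mpolyP => u; rewrite summxE raddf_sum /=.
under eq_bigr do rewrite mcoeff_gfree_comp.
have [x0|x0] := eqVneq ((x 0 i)@_u) 0.
  by rewrite x0 big1 // => p _; rewrite if_same.
rewrite -big_mkcond -big_filter /=.
rewrite (eq_filter (a2 := pred1 (d`_i + (mdeg u)%:Z))) //.
rewrite filter_pred1_uniq ?undup_uniq ?big_seq1 // mem_undup.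
apply/allpairsPdep; exists i, (mdeg u); split=> //; first by rewrite mem_enum.
by rewrite mem_iota add0n /= msize_mdeg_lt // mcoeff_msupp.
Qed.

Fact gfree_gr_direct (s : seq int) (c : int -> V) :
  uniq s -> (forall p, gfree_gr p (c p)) -> \sum_(p <- s) c p = 0 ->
  forall p, p \in s -> c p = 0.
Proof.
move=> us hc c0 p ps; apply/rowP => i; apply/mpolyP => u; rewrite mxE mcoeff0.
apply/eqP/negbNE/negP => /[dup] cpN0 /(mhomogP _ _ (hc p i)) pE.
have: ((\sum_(q <- s) c q) 0 i)@_u = 0 by rewrite c0 mxE mcoeff0.
rewrite summxE raddf_sum /= (bigD1_seq p) //= big1 ?addr0 => [|q qp].
  by move/eqP; rewrite (negPf cpN0).
apply/eqP/negbNE/negP => /(mhomogP _ _ (hc q i)); rewrite -pE => /addIr qpE.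
by rewrite qpE eqxx in qp.
Qed.

(* The graded free module R(-d_0) (+) ... (+) R(-d_{r-1}), d = [:: d_0; ..]:  *)
(* its basis vector e_i has degree d_i, since R(-d)_p = R_{p-d}.              *)
Definition gfree : gmodule k n :=
  GModule gfree_gr0 gfree_grD gfree_grZ gfree_gr_sum gfree_gr_direct.

End GradedFree.

Section Generators.

Variables (k : fieldType) (n : nat) (M : gmodule k n).

(* A minimal system of homogeneous generators f_i, of respective degrees d_i. *)
Record min_gens (d : seq int) (f : 'I_(size d) -> M) : Prop := MinGens {
  min_gens_homog : forall i : 'I_(size d), gr M d`_i (f i);
  min_gens_span : forall x : M,
    exists c : 'I_(size d) -> {mpoly k[n]}, x = \sum_i c i *: f i;
  min_gens_irredundant : forall i, ~ exists c : 'I_(size d) -> {mpoly k[n]},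
    f i = \sum_(j | j != i) c j *: f j
}.

(* All the minimal generators of M (there are finitely many of them) have     *)
(* their degree in D.                                                         *)
Definition generated_in_degrees (D : seq int) : Prop :=
  (exists (d : seq int) (f : 'I_(size d) -> M), min_gens f) /\
  (forall (d : seq int) (f : 'I_(size d) -> M), min_gens f -> {subset d <= D}).

Variables (d : seq int) (f : 'I_(size d) -> M).

Definition gens_fun (v : gfree k n d) : M :=
  \sum_(i < size d) (v : 'rV_(size d)) 0 i *: f i.

Fact gens_fun_linear : linear gens_fun.
Proof.
move=> a u v; rewrite /gens_fun scaler_sumr -big_split; apply: eq_bigr => i _.
by rewrite /= !mxE scalerDl scalerA.
Qed.

HB.instance Definition _ :=
  GRing.isLinear.Build {mpoly k[n]} (gfree k n d) M _ gens_fun gens_fun_linear.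

Hypothesis hf : forall i : 'I_(size d), gr M d`_i (f i).

Fact gens_fun_gr p x : gr (gfree k n d) p x -> gr M p (gens_fun x).
Proof.
move=> hx; apply: (big_ind (gr M p)); [exact: gr0|exact: grD|move=> i _].
move: (hx i); case E: (p - _) => [q|q] /= hq.
  by rewrite -(subrK d`_i p) E addrC; apply: grZ.
by rewrite (eqP hq) scale0r; apply: gr0.
Qed.

Definition gens_mor : gmor (gfree k n d) M := GMor gens_fun_gr.

(* The module of syzygies of the f_i: the (c_i) with \sum_i c_i f_i = 0,      *)
(* graded so that c has degree p when every c_i f_i has degree p.             *)
Definition syzygies : gmodule k n := gker gens_mor.

End Generators.

Definition syzygies_generated_in_degrees (k : fieldType) (n : nat)
    (M : gmodule k n) (D : seq int) : Prop :=
  forall (d : seq int) (f : 'I_(size d) -> M) (hf : min_gens f),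
    generated_in_degrees (syzygies (min_gens_homog hf)) D.

(* Minimal graded free resolutions                                            *)
(*   ... -> res_term 2 -> res_term 1 -> res_term 0 -> M -> 0,                 *)
(* the i-th term being the sum of the R(-j), for j in the sequence res_deg i. *)
(* Minimality: the entries of the differentials lie in (x_0, x_1, ...), that  *)
(* is, they have no constant term.                                            *)
Record min_resolution (k : fieldType) (n : nat) (M : gmodule k n) :=
    MinResolution {
  res_deg : nat -> seq int;
  res_term := fun i => gfree k n (res_deg i);
  res_aug : gmor (res_term 0%N) M;
  res_diff : forall i, gmor (res_term i.+1) (res_term i);
  res_aug_surj : surj res_aug;
  res_exact0 : forall x,
    res_aug x = 0 <-> exists y, res_diff 0%N y = x;
  res_exactS : forall i x,
    res_diff i x = 0 <-> exists y, res_diff i.+1 y = x;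
  res_minimal : forall i y (j : 'I_(size (res_deg i))),
    ((res_diff i y : 'rV_(size (res_deg i))) 0 j)@_0%MM = 0
}.

(* The graded Betti number beta_{i,j}(M). The minimal graded free resolution  *)
(* is unique up to isomorphism, so it does not matter which one is chosen.    *)
Definition betti (k : fieldType) (n : nat) (M : gmodule k n) (i : nat) (j : int)
    : nat :=
  epsilon (inhabits 0%N)
    (fun b => exists C : min_resolution M, b = count_mem j (res_deg C i)).

(* The i-th term of the minimal resolution is R(-m-i)^b, for 0 <= i <= l.     *)
Definition linearly_presented (k : fieldType) (n : nat) (M : gmodule k n)
    (m : int) (l : nat) : Prop :=
  exists C : min_resolution M,
    forall i : nat, (i <= l)%N -> all (pred1 (m + i%:Z)) (res_deg C i).

(* A choice of the maps mu^i induced by mu on the resolutions, which are only *)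
(* determined up to homotopy.                                                 *)
Record lifting (k : fieldType) (n : nat) (M N : gmodule k n) (mu : gmor M N)
    (C : min_resolution M) (D : min_resolution N) := Lifting {
  lift_map :> forall i, gmor (res_term C i) (res_term D i);
  lift_aug : forall x, res_aug D (lift_map 0%N x) = mu (res_aug C x);
  lift_diff : forall i x,
    res_diff D i (lift_map i.+1 x) = lift_map i (res_diff C i x)
}.

(* Main.v *)
(* Both E^0 and G^0 are generated in degree m, so mu^0 is a surjective matrix of
   scalars and its kernel splits off E^0 as a free summand K0; the same holds for
   K1 = ker mu^1 inside E^1, in degree m+1, when mu^1 is surjective.  A diagram
   chase shows that F is generated by e_0(K0) and by lifts of g_1 of the basis of G^1,
   the latter being superfluous when mu^1 is surjective; its syzygies are then
   e_1(w) for w with mu^1(w) in the image of g_2, hence are generated by e_1(K1)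
   and by lifts of g_2 of the basis of G^2, the latter being superfluous when mu^2 is
   surjective.  Reducing modulo (x_0, ..., x_n) shows that these generators are
   minimal.  The Betti numbers can be read off any minimal resolution, since
   comparison maps reduce to mutually inverse scalar matrices, and such
   resolutions exist by Hilbert's basis theorem. *)

Require Import Defs.
From Stdlib Require Import Classical ClassicalEpsilon.
From HB Require Import structures.
From mathcomp Require Import all_boot all_order all_algebra.
From mathcomp Require Import mpoly.

Set Implicit Arguments.
Unset Strict Implicit.
Unset Printing Implicit Defensive.

Import Order.TTheory GRing.Theory Num.Theory.
Local Open Scope ring_scope.

(** * Hilbert's basis theorem *)

(** Induction on the number [j] of coordinates compared. If [s] works for the first [j], it settles
    every [u] whose next coordinate is at least the maximum [N] over [s]; each of the finitely many
    smaller values gives a slice with its own finite set. *)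
Lemma dickson_prefix (n : nat) (j : nat) (L : 'X_{1..n} -> Prop) :
  exists s : seq 'X_{1..n}, (forall v, v \in s -> L v) /\
    forall u, L u -> exists2 v, v \in s & forall i : 'I_n, (i < j)%N -> (v i <= u i)%N.
Proof.
elim: j L => [|j IHj] L.
  have [[u Lu]|noL] := classic (exists u, L u).
    exists [:: u]; split=> [v|w _]; first by rewrite inE => /eqP->.
    by exists u; rewrite ?inE.
  by exists [::]; split=> // u Lu; case: noL; exists u.
have [jn|nj] := ltnP j n; last first.
  have [s [sL hs]] := IHj L; exists s; split=> // u /hs[v vs hv].
  by exists v => // i _; apply: hv; apply: leq_trans (ltn_ord i) nj.
pose j' := Ordinal jn.
have [s [sL hs]] := IHj L.
pose N := \max_(v <- s) v j'.
have [t [tL ht]] : exists t : seq 'X_{1..n}, (forall v, v \in t -> L v) /\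
    forall u, L u -> (u j' < N)%N ->
      exists2 v, v \in t & forall i : 'I_n, (i < j.+1)%N -> (v i <= u i)%N.
  elim: N => [|N [t [tL ht]]]; first by exists [::].
  have [t' [tL' ht']] := IHj (fun u => L u /\ u j' = N).
  exists (t ++ t'); split=> [v|u Lu].
    by rewrite mem_cat => /orP[/tL|/tL'[]].
  rewrite ltnS leq_eqVlt => /orP[/eqP uN|/(ht u Lu)[v vt hv]].
    have [v vt hv] := ht' u (conj Lu uN).
    exists v; rewrite ?mem_cat ?vt ?orbT // => i.
    rewrite ltnS leq_eqVlt => /orP[/eqP ij|/hv//].
    have -> : i = j' by apply: val_inj.
    by rewrite uN; case: (tL' _ vt) => _ ->.
  by exists v; rewrite ?mem_cat ?vt.
exists (s ++ t); split=> [v|u Lu].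
  by rewrite mem_cat => /orP[/sL|/tL].
have [uN|Nu] := ltnP (u j') N.
  by have [v vt hv] := ht u Lu uN; exists v; rewrite ?mem_cat ?vt ?orbT.
have [v vs hv] := hs u Lu; exists v; rewrite ?mem_cat ?vs // => i.
rewrite ltnS leq_eqVlt => /orP[/eqP ij|/hv//].
have -> : i = j' by apply: val_inj.
by apply: leq_trans Nu; apply: (leq_bigmax_seq (F := fun w : 'X_{1..n} => w j') v).
Qed.

Lemma dickson (n : nat) (L : 'X_{1..n} -> Prop) :
  exists s : seq 'X_{1..n}, (forall v, v \in s -> L v) /\
    forall u, L u -> exists2 v, v \in s & (v <= u)%MM.
Proof.
have [s [sL hs]] := dickson_prefix n L; exists s; split=> // u /hs[v vs hv].
by exists v => //; apply/mnm_lepP => i; apply: hv.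
Qed.

(** Coefficients are indexed by [nat] to avoid casts along [size s]; those beyond [size s] are
    ignored. *)
Definition spanned (R : pzRingType) (M : lmodType R) (s : seq M) (x : M) : Prop :=
  exists c : nat -> R, x = \sum_(i < size s) c i *: s`_i.

Section Spanned.

Variables (R : pzRingType) (M : lmodType R).
Implicit Types (s t : seq M) (x y : M).

Lemma spanned0 s : spanned s 0.
Proof. by exists (fun=> 0); rewrite big1 // => i _; rewrite scale0r. Qed.

Lemma spannedD s x y : spanned s x -> spanned s y -> spanned s (x + y).
Proof.
move=> [c ->] [c' ->]; exists (fun i => c i + c' i).
by rewrite -big_split; apply: eq_bigr => i _; rewrite scalerDl.
Qed.

Lemma spannedZ s a x : spanned s x -> spanned s (a *: x).
Proof.
move=> [c ->]; exists (fun i => a * c i).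
by rewrite scaler_sumr; apply: eq_bigr => i _; rewrite scalerA.
Qed.

Lemma spanned_mem s x : x \in s -> spanned s x.
Proof.
move=> xs; have ix : (index x s < size s)%N by rewrite index_mem.
exists (fun i => (i == index x s)%:R); rewrite (bigD1 (Ordinal ix)) //= eqxx.
rewrite scale1r nth_index // big1 ?addr0 // => i /negPf ni.
by rewrite -val_eqE /= in ni; rewrite ni scale0r.
Qed.

Lemma spanned_sub s t x : {subset s <= t} -> spanned s x -> spanned t x.
Proof.
move=> st [c ->]; apply: (big_ind (spanned t)) => [||i _].
- exact: spanned0.
- exact: spannedD.
- by apply/spannedZ/spanned_mem/st/mem_nth.
Qed.

End Spanned.

Definition submodule (R : pzRingType) (M : lmodType R) (N : M -> Prop) : Prop :=
  [/\ N 0, forall x y, N x -> N y -> N (x + y) & forall a x, N x -> N (a *: x)].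

(** Dickson's lemma gives finitely many leading monomials of [I] that divide all the others;
    elements realizing them generate [I], by division and induction on the leading monomial. *)
Lemma hilbert_basis (k : fieldType) (n : nat) (I : {mpoly k[n]}^o -> Prop) :
  submodule I ->
  exists s : seq {mpoly k[n]}^o,
    (forall f, f \in s -> I f) /\ (forall f, I f -> spanned s f).
Proof.
move=> [I0 ID IZ].
have [s [sL hs]] := dickson (fun u => exists f, [/\ I f, f != 0 & mlead f = u]).
have [t [tI ht]] : exists t : seq {mpoly k[n]}^o, (forall f, f \in t -> I f) /\
    forall v, v \in s -> exists2 f, f \in t & f != 0 /\ mlead f = v.
  elim: s sL {hs} => [|u s IHs] sL; first by exists [::].
  have [|t [tI ht]] := IHs; first by move=> v vs; apply: sL; rewrite inE vs orbT.
  have [|f [If f0 fu]] := sL u; first by rewrite inE eqxx.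
  exists (f :: t); split=> [g|v]; first by rewrite inE => /orP[/eqP->|/tI].
  rewrite inE => /orP[/eqP->|/ht[g gt hg]].
    by exists f; rewrite ?inE ?eqxx.
  by exists g; rewrite ?inE ?gt ?orbT.
exists t; split=> // f.
elim/mleadrect: f => f IHf If.
have [->|f0] := eqVneq f 0; first exact: spanned0.
have [v vs vf] := hs (mlead f) (ex_intro _ f (And3 If f0 erefl)).
have [g gt [g0 gv]] := ht v vs.
(* The multiple of [g] by [a] cancels the leading term of [f]. *)
pose a : {mpoly k[n]} := (mleadc f / mleadc g) *: 'X_[mlead f - v].
have agI : I (a *: g) by apply/IZ/tI.
rewrite -(subrK (a *: g) f); apply: spannedD; last exact/spannedZ/spanned_mem.
have Ifg : I (f - a *: g).
  by rewrite -(scaleN1r (a *: g)); apply: ID => //; apply: IZ.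
have [->|fg0] := eqVneq (f - a *: g) 0; first exact: spanned0.
apply: IHf => //; rewrite lt_neqAle; apply/andP; split; last first.
  apply: le_trans (mleadB_le _ _) _; rewrite leUx lexx andTb.
  apply: le_trans (mleadM_le _ _) _; rewrite gv -[leRHS](submK vf); apply: lem_add => //.
  by apply: le_trans (mleadZ_le _ _) _; rewrite mleadXm.
have ag : (a *: g)@_(mlead f) = mleadc f.
  have -> : a *: g = (mleadc f / mleadc g) *: ((g : {mpoly k[n]}) * 'X_[mlead f - v]).
    by rewrite -[LHS]/(a * g) /a -scalerAl (mulrC 'X_[_]).
  have {1}-> : mlead f = (mlead f - v + mlead g)%MM by rewrite gv submK.
  by rewrite mcoeffZ mcoeffMX divfK // mleadc_eq0.
apply/negP => /eqP E; move: fg0; rewrite -mleadc_eq0 E mcoeffB.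
by rewrite ag subrr eqxx.
Qed.

(** Induction on [j] over the vectors of [N] supported on the first [j] coordinates: their last
    coordinates form an ideal, finitely generated by [hilbert_basis], and subtracting a combination
    of lifts of its generators shortens the support. *)
Lemma rV_noetherian (k : fieldType) (n r : nat) (N : 'rV[{mpoly k[n]}]_r -> Prop) :
  submodule N ->
  exists s : seq 'rV[{mpoly k[n]}]_r,
    (forall x, x \in s -> N x) /\ (forall x, N x -> spanned s x).
Proof.
move=> subN.
have key : forall j, (j <= r)%N -> exists s : seq 'rV[{mpoly k[n]}]_r,
    (forall x, x \in s -> N x) /\
    (forall x, N x -> (forall i : 'I_r, (j <= i)%N -> x 0 i = 0) -> spanned s x).
  case: subN => N0 ND NZ; elim=> [_|j IHj jr].
    exists [::]; split=> // x _ x0; have -> : x = 0; last exact: spanned0.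
    by apply/rowP => i; rewrite mxE x0.
  have [s [sN hs]] := IHj (ltnW jr).
  pose j' := Ordinal jr.
  pose N' x := N x /\ (forall i : 'I_r, (j < i)%N -> x 0 i = 0).
  have N'Z a x : N' x -> N' (a *: x).
    by move=> [Nx x0]; split=> [|i ji]; [exact: NZ|rewrite mxE x0 ?mulr0].
  have N'D x y : N' x -> N' y -> N' (x + y).
    move=> [Nx x0] [Ny y0]; split=> [|i ji]; first exact: ND.
    by rewrite mxE x0 ?y0 ?addr0.
  have N'0 : N' 0 by split=> // i _; rewrite mxE.
  have [|t [tI ht]] := @hilbert_basis k n (fun f => exists2 x, N' x & x 0 j' = f).
    split=> [|f g [x Nx <-] [y Ny <-]|a f [x Nx <-]].
    - by exists 0; rewrite ?mxE.
    - by exists (x + y); rewrite ?mxE //; apply: N'D.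
    - by exists (a *: x); rewrite ?mxE //; apply: N'Z.
  have [t' [tN' ht']] : exists t' : seq 'rV[{mpoly k[n]}]_r,
      (forall x, x \in t' -> N' x) /\ [seq (x : 'rV_r) 0 j' | x <- t'] = t.
    elim: t tI {ht} => [|f t IHt] tI; first by exists [::].
    have [|t' [tN' ht']] := IHt; first by move=> g gt; apply: tI; rewrite inE gt orbT.
    have [|x Nx xf] := tI f; first by rewrite inE eqxx.
    exists (x :: t'); split=> [y|]; last by rewrite /= xf ht'.
    by rewrite inE => /orP[/eqP->|/tN'].
  exists (s ++ t'); split=> [x|x Nx x0].
    by rewrite mem_cat => /orP[/sN|/tN'[]].
  have [c xE] := ht (x 0 j') (ex_intro2 _ _ x (conj Nx x0) erefl).
  pose y := \sum_(i < size t') c i *: t'`_i.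
  have yt : spanned t' y by exists c.
  have N'y : N' y.
    by apply: (big_ind N') => // i _; apply/N'Z/tN'/mem_nth.
  have yj : y 0 j' = x 0 j'.
    rewrite xE summxE -ht' size_map; apply: eq_bigr => i _.
    by rewrite mxE (nth_map 0).
  rewrite -(subrK y x); apply: spannedD; last first.
    by apply: spanned_sub yt => z; rewrite mem_cat orbC => ->.
  apply: (spanned_sub (s := s)) => [z|]; first by rewrite mem_cat => ->.
  have [Nxy xy0] : N' (x - y) by rewrite -scaleN1r; apply: N'D => //; apply: N'Z.
  apply: hs => // i; rewrite leq_eqVlt => /orP[/eqP ij|/xy0//].
  have -> : i = j' by apply: val_inj.
  by rewrite !mxE yj subrr.
have [s [sN hs]] := key r (leqnn r); exists s; split=> // x Nx.
by apply: hs => // i; rewrite leqNgt ltn_ord.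
Qed.

Lemma fin_gen_gker (k : fieldType) (n : nat) (d : seq int) (M : gmodule k n)
  (f : gmor (gfree k n d) M) : fin_gen (gker f).
Proof.
have [|s [sN hs]] := @rV_noetherian k n (size d) (fun v => f v = 0).
  split=> [|x y fx fy|a x fx]; first exact: linear0.
  - by rewrite linearD fx fy addr0.
  - by rewrite linearZZ fx scaler0.
have kerP (i : 'I_(size s)) : s`_i \in lker_pred f.
  by rewrite unfold_in; apply/eqP/sN/mem_nth.
exists (size s), (fun i => LkerElt (kerP i)) => x.
have [c xE] := hs _ (lker_valP x).
by exists (fun i => c i); apply: val_inj; rewrite /= xE raddf_sum.
Qed.

(** * Minimal systems of generators *)

Section MinimalGenerators.

Variables (k : fieldType) (n : nat) (M : gmodule k n).

(** Pure reindexing: redundant generators are easier to discard inside a subset of a finite type,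
    whereas [min_gens] numbers them by ordinals. *)
Lemma min_gens_irredundant_set (I : finType) (deg : I -> int) (f : I -> M)
    (A : {set I}) :
  (forall i, i \in A -> gr M (deg i) (f i)) ->
  (forall x : M, exists c : I -> {mpoly k[n]}, x = \sum_(i in A) c i *: f i) ->
  (forall i, i \in A -> ~ exists c : I -> {mpoly k[n]},
     f i = \sum_(j in A :\ i) c j *: f j) ->
  exists (d : seq int) (g : 'I_(size d) -> M),
    min_gens g /\ {subset d <= codom deg}.
Proof.
move=> hom spn irr.
pose d := [seq deg i | i <- enum A].
have sd : size d = #|A| by rewrite size_map -cardE.
pose ev j := enum_val (cast_ord sd j).
have ev_inj : injective ev by move=> i j /enum_val_inj/cast_ord_inj.
have evA j : ev j \in A by apply: enum_valP.
have AE : A = ev @: setT.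
  apply/setP => i; apply/idP/imsetP => [iA|[j _ ->//]].
  exists (cast_ord (esym sd) (enum_rank_in iA i)) => //.
  by rewrite /ev cast_ordKV enum_rankK_in.
have ev_deg (j : 'I_(size d)) : d`_j = deg (ev j).
  have jA : (j < size (enum A))%N by rewrite -cardE -sd.
  by rewrite /d (nth_map (ev j)) //; congr deg; rewrite [RHS](enum_val_nth (ev j)).
pose ext (c : 'I_(size d) -> {mpoly k[n]}) i := \sum_(j | ev j == i) c j.
have extE c j : ext c (ev j) = c j.
  rewrite /ext -[RHS](big_pred1_eq +%R j c).
  by apply: eq_bigl => l; rewrite (inj_eq ev_inj).
exists d, (f \o ev); split; last first.
  by move=> _ /mapP[i _ ->]; apply: codom_f.
split=> [j|x|j [c fj]]; first by rewrite ev_deg; apply: hom.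
  have [c ->] := spn x; exists (c \o ev).
  rewrite {1}AE big_imset /=; last by move=> ? ? _ _; apply: ev_inj.
  by apply: eq_bigl => i; rewrite inE.
apply: (irr (ev j)) => //; exists (ext c); rewrite [LHS]fj.
have -> : A :\ ev j = ev @: [set l | l != j].
  apply/setP => i; rewrite in_setD1; apply/andP/imsetP => [[ij]|[l]].
    rewrite {1}AE => /imsetP[l _ il]; exists l => //.
    by rewrite inE; apply: contraNneq ij => <-; rewrite il.
  by rewrite inE => lj ->; rewrite (inj_eq ev_inj).
rewrite big_imset /=; last by move=> ? ? _ _; apply: ev_inj.
by apply: eq_big => [l|l _]; rewrite ?inE // extE.
Qed.

(** Redundant members are discarded one at a time, by induction on a bound for the number of those
    left. *)
Lemma min_gens_of_family (I : finType) (deg : I -> int) (f : I -> M) :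
  (forall i, gr M (deg i) (f i)) ->
  (forall x : M, exists c : I -> {mpoly k[n]}, x = \sum_i c i *: f i) ->
  exists (d : seq int) (g : 'I_(size d) -> M),
    min_gens g /\ {subset d <= codom deg}.
Proof.
move=> hom spn.
have hom' (A : {set I}) i : i \in A -> gr M (deg i) (f i) by [].
have spnT (x : M) : exists c : I -> {mpoly k[n]}, x = \sum_(i in [set: I]) c i *: f i.
  by have [c ->] := spn x; exists c; apply: eq_bigl => i; rewrite inE.
have [N] := ubnPleq #|[set: I]|; move: [set: I] spnT.
elim: N => [|N IH] A spnA.
  rewrite leqn0 cards_eq0 => /eqP A0.
  by apply: (min_gens_irredundant_set (hom' A) spnA) => i; rewrite A0 inE.
move=> AN.
have [[i iA [c fi]]|irr] := classic (exists2 i, i \in A &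
    exists c : I -> {mpoly k[n]}, f i = \sum_(j in A :\ i) c j *: f j); last first.
  apply: (min_gens_irredundant_set (hom' A) spnA) => i iA [c fi].
  by apply: irr; exists i => //; exists c.
have AiN : (#|A :\ i| <= N)%N by move: AN; rewrite (cardsD1 i) iA.
apply: (IH (A :\ i)) => // x.
have [a ->] := spnA x; exists (fun j => a j + a i * c j).
rewrite (big_setD1 i) //= fi scaler_sumr addrC -big_split /=.
by apply: eq_bigr => j _; rewrite scalerDl scalerA.
Qed.

(** Generators in [fin_gen] need not be homogeneous, so they are first replaced by their homogeneous
    components. *)
Lemma fin_gen_min_gens : fin_gen M ->
  exists (d : seq int) (g : 'I_(size d) -> M), min_gens g.
Proof.
move=> [r [f spn]].
have /fin_all_exists[s /fin_all_exists[c sc]] (i : 'I_r) := gr_sum (f i).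
pose deg (p : {i : 'I_r & 'I_(size (s i))}) := (s (tag p))`_(tagged p).
have [p|x|d [g [hg _]]] := @min_gens_of_family _ deg (fun p => c (tag p) (deg p)).
- by have [] := sc (tag p).
- have [a ->] := spn x; exists (fun p => a (tag p)).
  transitivity (\sum_(i < r) \sum_(q < size (s i)) a i *: c i (s i)`_q); last first.
    by rewrite sig_big_dep.
  apply: eq_bigr => i _; have [_ _ ->] := sc i.
  by rewrite (big_nth 0) big_mkord scaler_sumr.
- by exists d, g.
Qed.

End MinimalGenerators.

(** * Graded free modules *)

Section GradedMorphisms.

Variables (k : fieldType) (n : nat).
Implicit Types (M N P : gmodule k n).

Lemma grB M p (x y : M) : gr M p x -> gr M p y -> gr M p (x - y).
Proof.
move=> hx hy; apply: grD => //; rewrite -scaleN1r -[p]addr0.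
by apply: (grZ (d := 0)) => //; rewrite rpredN dhomog1.
Qed.

(** The component of degree [p] of [a] has the same image as [a], because [g] preserves degrees and
    [g a] lies in degree [p]. *)
Lemma gr_lift M N (g : gmor M N) p (a : M) :
  gr N p (g a) -> exists2 a', gr M p a' & g a' = g a.
Proof.
move=> hb; have [s [c [us hc aE]]] := gr_sum a.
(* Outside [s] the family [c] does not contribute to [a], so it is replaced by 0 there. *)
pose c' q := if q \in s then c q else 0.
have hc' q : gr M q (c' q) by rewrite /c'; case: ifP => // _; apply: gr0.
exists (c' p) => //; apply/eqP; rewrite -subr_eq0; apply/eqP.
(* [p] is added because it need not lie in [s]. The family [e] below sums to zero over [s'], so
   directness kills its member at [p]. *)
pose s' := undup (p :: s).
pose e q := g (c' q) - if q == p then g a else 0.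
have -> : g (c' p) - g a = e p by rewrite /e eqxx.
have ps' : p \in s' by rewrite mem_undup inE eqxx.
apply: (@gr_direct _ _ N s' e) => // [|q|]; first exact: undup_uniq.
  apply: grB; first exact: gmorP.
  by case: eqP => [->//|_]; apply: gr0.
rewrite sumrB -big_mkcond -[in X in _ - X]big_filter.
rewrite (eq_filter (a2 := pred1 p)) // filter_pred1_uniq ?undup_uniq // big_seq1.
rewrite -raddf_sum [in X in _ - X]aE; apply/eqP; rewrite subr_eq0; apply/eqP; congr (g _).
rewrite -big_mkcond -big_filter; apply: perm_big; apply: uniq_perm => //.
  by rewrite filter_uniq ?undup_uniq.
by move=> q; rewrite mem_filter mem_undup inE; case: (q \in s); rewrite ?orbT.
Qed.

Definition gmor_comp M N P (g : gmor N P) (f : gmor M N) : gmor M P :=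
  @GMor k n M P (g \o f) (fun p x hx => gmorP g (gmorP f hx)).

Definition gmor_sub M N (f g : gmor M N) : gmor M N :=
  @GMor k n M N (f \- g) (fun p x hx => grB (gmorP f hx) (gmorP g hx)).

Definition gmor_id M : gmor M M := @GMor k n M M idfun (fun p x hx => hx).

End GradedMorphisms.

Section FreeModules.

Variables (k : fieldType) (n : nat).

Definition gbasis (d : seq int) (i : 'I_(size d)) : gfree k n d :=
  (delta_mx 0 i : 'rV_(size d)).

Lemma gbasis_gr (d : seq int) (i : 'I_(size d)) : gr (gfree k n d) d`_i (gbasis i).
Proof.
move=> j; rewrite mxE eqxx /=; have [->|ji] := eqVneq j i.
  by rewrite subrr; exact: (dhomog1 _ mdeg).
by apply/mhomogP => u; rewrite mcoeff0 eqxx.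
Qed.

Lemma gbasis_sum (d : seq int) (v : gfree k n d) :
  v = \sum_i (v : 'rV_(size d)) 0 i *: gbasis i.
Proof. exact: (row_sum_delta (v : 'rV_(size d))). Qed.

Lemma gmor_basis (d : seq int) (M : gmodule k n) (f : gmor (gfree k n d) M) v :
  f v = \sum_i (v : 'rV_(size d)) 0 i *: f (gbasis i).
Proof.
by rewrite {1}[v]gbasis_sum linear_sum; apply: eq_bigr => i _; rewrite linearZZ.
Qed.

(** By [gr_lift] the preimages of the basis vectors can be taken homogeneous of the right degrees,
    so the map they define is graded. *)
Lemma gfree_projective (M N : gmodule k n) (g : gmor M N) (d : seq int)
    (f : gmor (gfree k n d) N) :
  (forall i, exists a, g a = f (gbasis i)) ->
  exists h : gmor (gfree k n d) M, forall x, g (h x) = f x.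
Proof.
move=> gf.
have /fin_all_exists[a ha] (i : 'I_(size d)) :
    exists a, gr M d`_i a /\ g a = f (gbasis i).
  have [a ga] := gf i; have := gmorP f (gbasis_gr i); rewrite -ga => /gr_lift[a' ha' <-].
  by exists a'.
exists (gens_mor (fun i => (ha i).1)) => x.
rewrite [RHS]gmor_basis /= /gens_fun linear_sum.
by apply: eq_bigr => i _; rewrite linearZZ (ha i).2.
Qed.

(* The reduction of a free module modulo the irrelevant ideal. *)
Definition cst (d : seq int) (v : gfree k n d) : 'rV[k]_(size d) :=
  map_mx (mcoeff 0%MM) (v : 'rV_(size d)).

Definition cmx (d d' : seq int) (f : gfree k n d -> gfree k n d') :
    'M[k]_(size d, size d') := \matrix_i cst (f (gbasis i)).

Lemma cstD d (u v : gfree k n d) : cst (u + v) = cst u + cst v.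
Proof. by apply/rowP => i; rewrite !mxE mcoeffD. Qed.

Lemma cstB d (u v : gfree k n d) : cst (u - v) = cst u - cst v.
Proof. by apply/rowP => i; rewrite !mxE mcoeffB. Qed.

Lemma cst0 d : cst (0 : gfree k n d) = 0.
Proof. by apply/rowP => i; rewrite !mxE mcoeff0. Qed.

Lemma cstZ d a (v : gfree k n d) : cst (a *: v) = a@_0%MM *: cst v.
Proof. by apply/rowP => i; rewrite !mxE -rmorphM. Qed.

Lemma cst_sum d (I : finType) (F : I -> gfree k n d) :
  cst (\sum_i F i) = \sum_i cst (F i).
Proof. exact: (big_morph _ (@cstD d) (@cst0 d)). Qed.

Lemma cst_gbasis d i : cst (@gbasis d i) = delta_mx 0 i.
Proof. by apply/rowP => j; rewrite !mxE mcoeffMn mcoeff1 eqxx. Qed.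

Lemma cst_gmor d d' (f : gmor (gfree k n d) (gfree k n d')) v :
  cst (f v) = cst v *m cmx f.
Proof.
rewrite gmor_basis cst_sum mulmx_sum_row; apply: eq_bigr => i _.
by rewrite cstZ rowK !mxE.
Qed.

Lemma cst_gr d p (v : gfree k n d) j : gr (gfree k n d) p v -> cst v 0 j != 0 -> p = d`_j.
Proof.
move=> /(_ j)/mhomogP hv; rewrite mxE => /hv.
by rewrite mdeg0 => /eqP; rewrite subr_eq0 => /eqP.
Qed.

Lemma cmx_deg d d' (f : gmor (gfree k n d) (gfree k n d')) i j :
  cmx f i j != 0 -> d`_i = d'`_j.
Proof. by rewrite mxE; apply: cst_gr; apply/gmorP/gbasis_gr. Qed.

(** The coordinate is homogeneous of degree 0, hence a scalar. *)
Lemma gfree_coord_const (d : seq int) p (v : gfree k n d) (j : 'I_(size d)) :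
  gr (gfree k n d) p v -> d`_j = p -> (v : 'rV_(size d)) 0 j = (cst v 0 j)%:MP.
Proof.
move=> hv dj; rewrite mxE; have := hv j; rewrite dj subrr => /dhomogP h0.
apply/mpolyP => u; rewrite mcoeffC; case: eqP => [<-|/eqP u0]; rewrite ?mulr1 // mulr0.
apply/memN_msupp_eq0/negP => /h0/eqP; rewrite mdeg_eq0 => u0'.
by rewrite u0' in u0.
Qed.

Lemma gfree_const (d : seq int) p (v : gfree k n d) : all (pred1 p) d ->
  gr (gfree k n d) p v -> v = map_mx (@mpolyC n k) (cst v) :> 'rV_(size d).
Proof.
move=> /allP dp hv; apply/rowP => j; rewrite [RHS]mxE.
by apply: gfree_coord_const hv _; apply/eqP/dp/mem_nth.
Qed.

Lemma gmor_const d d' p (f : gmor (gfree k n d) (gfree k n d')) v :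
  all (pred1 p) d -> all (pred1 p) d' ->
  f v = (v : 'rV_(size d)) *m map_mx (@mpolyC n k) (cmx f) :> 'rV_(size d').
Proof.
move=> dp dp'; rewrite gmor_basis mulmx_sum_row; apply: eq_bigr => i _.
congr (_ *: _); rewrite -map_row rowK; apply: (gfree_const dp').
have <- : d`_i = p by apply/eqP/(allP dp)/mem_nth.
exact/gmorP/gbasis_gr.
Qed.

Lemma gr_const d p (b : 'rV[k]_(size d)) : all (pred1 p) d ->
  gr (gfree k n d) p (map_mx (@mpolyC n k) b).
Proof.
move=> /allP dp; rewrite /gr /= => j.
rewrite mxE (eqP (dp _ (mem_nth 0 (ltn_ord j)))) subrr.
apply/mhomogP => u; rewrite mcoeffC.
by have [->|_] := eqVneq u 0%MM; rewrite ?mdeg0 // mulr0 eqxx.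
Qed.

(** [A] has no entry between different degrees, so the degree [p] blocks of [A] and [B] still
    multiply to the identity; the block of [A] then has at least as many columns as rows. *)
Lemma count_mem_le_of_left_inverse (d d' : seq int) p
    (A : 'M[k]_(size d, size d')) (B : 'M[k]_(size d', size d)) :
  (forall i j, A i j != 0 -> d`_i = d'`_j) -> A *m B = 1%:M ->
  (count_mem p d <= count_mem p d')%N.
Proof.
move=> Adeg AB.
have cntE (e : seq int) : count_mem p e = #|[set i : 'I_(size e) | e`_i == p]|.
  rewrite -sum1_count (big_nth 0) big_mkord -sum1_card.
  by apply: eq_bigl => i; rewrite inE.
rewrite !cntE; set S := [set _ | _]; set S' := [set _ | _].
pose ev (i : 'I_#|S|) := enum_val i; pose ev' (i : 'I_#|S'|) := enum_val i.
apply: (@mulmx1_min k _ _ (mxsub ev ev' A) (mxsub ev' ev B)).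
apply/matrixP => i j; have := congr1 (fun X : 'M_(size d) => X (ev i) (ev j)) AB.
rewrite !mxE (inj_eq enum_val_inj) => <-.
rewrite (bigID (mem S')) /= [X in _ + X]big1 ?addr0 => [|l lS'].
  rewrite /= [RHS](eq_bigl (fun l => l \in S')) // [RHS]big_enum_val.
  by apply: eq_bigr => l _; rewrite !mxE.
apply/eqP; rewrite mulf_eq0; apply/orP; left; apply: contraNT lS' => /Adeg.
by have := enum_valP i; rewrite !inE => /eqP-> <-.
Qed.

End FreeModules.

Arguments gbasis {k n d} i.

(** * Minimal resolutions *)

Section Resolutions.

Variables (k : fieldType) (n : nat).
Implicit Types M : gmodule k n.

Lemma res_diffK M (C : min_resolution M) i x : res_diff C i (res_diff C i.+1 x) = 0.
Proof. by apply/res_exactS; exists x. Qed.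

Lemma cst_res_diff M (C : min_resolution M) i x : cst (res_diff C i x) = 0.
Proof. by apply/rowP => j; rewrite [LHS]mxE [RHS]mxE; apply: res_minimal. Qed.

(* [phi] and [psi] are the degree [i] parts of chain maps over the identity of
   [M], and [h] is a piece of a homotopy from [psi \o phi] to the identity. *)
Lemma res_comparison M (C D : min_resolution M) i :
  exists (phi : gmor (res_term C i) (res_term D i))
         (psi : gmor (res_term D i) (res_term C i))
         (h : gmor (res_term C i) (res_term C i.+1)),
    [/\ forall y, exists z, phi (res_diff C i y) = res_diff D i z,
        forall y, exists z, psi (res_diff D i y) = res_diff C i z,
        forall y, psi (phi (res_diff C i y)) - res_diff C i y
          = res_diff C i (h (res_diff C i y))
      & forall x, cst (psi (phi x)) = cst x].
Proof.
elim: i => [|i [phi [psi [h [phid psid hd _]]]]].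
  have [phi phiE] := gfree_projective
    (fun i => @res_aug_surj _ _ _ D (res_aug C (gbasis i))).
  have [psi psiE] := gfree_projective
    (fun i => @res_aug_surj _ _ _ C (res_aug D (gbasis i))).
  (* The augmentation kills [f], so [f] factors through the first differential. *)
  pose f := gmor_sub (gmor_comp psi phi) (gmor_id (res_term C 0%N)).
  have fim x : exists y, res_diff C 0%N y = f x.
    by apply/res_exact0; rewrite /= linearB /= psiE phiE subrr.
  have [h hE] := gfree_projective (fun i => fim (gbasis i)).
  exists phi, psi, h; split=> [y|y|y|x].
  - have [z zE] : exists z, res_diff D 0%N z = phi (res_diff C 0%N y).
      by apply/res_exact0; rewrite phiE; apply/res_exact0; exists y.
    by exists z.
  - have [z zE] : exists z, res_diff C 0%N z = psi (res_diff D 0%N y).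
      by apply/res_exact0; rewrite psiE; apply/res_exact0; exists y.
    by exists z.
  - by rewrite hE.
  - by apply/eqP; rewrite -subr_eq0 -cstB; apply/eqP; rewrite -[_ - _]hE cst_res_diff.
have [phi' phiE] : exists phi' : gmor (res_term C i.+1) (res_term D i.+1),
    forall x, res_diff D i (phi' x) = gmor_comp phi (res_diff C i) x.
  by apply: gfree_projective => j; have [z zE] := phid (gbasis j); exists z; rewrite -zE.
have [psi' psiE] : exists psi' : gmor (res_term D i.+1) (res_term C i.+1),
    forall x, res_diff C i (psi' x) = gmor_comp psi (res_diff D i) x.
  by apply: gfree_projective => j; have [z zE] := psid (gbasis j); exists z; rewrite -zE.
(* The clause [hd] makes the values of [f] cycles, so [f] lifts to the next piece [h'] of the
   homotopy. *)
pose f := gmor_sub (gmor_sub (gmor_comp psi' phi') (gmor_id (res_term C i.+1)))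
  (gmor_comp h (res_diff C i)).
have fim x : exists y, res_diff C i.+1 y = f x.
  by apply/res_exactS; rewrite /= !linearB /= psiE /= phiE /= hd subrr.
have [h' hE] := gfree_projective (fun j => fim (gbasis j)).
have psiphi x : psi' (phi' x) - x = res_diff C i.+1 (h' x) + h (res_diff C i x).
  by rewrite hE /= subrK.
exists phi', psi', h'; split=> [y|y|y|x].
- have [z zE] : exists z, res_diff D i.+1 z = phi' (res_diff C i.+1 y).
    by apply/res_exactS; rewrite phiE /= res_diffK linear0.
  by exists z.
- have [z zE] : exists z, res_diff C i.+1 z = psi' (res_diff D i.+1 y).
    by apply/res_exactS; rewrite psiE /= res_diffK linear0.
  by exists z.
- by rewrite psiphi res_diffK linear0 addr0.
(* Both terms of the homotopy formula reduce to zero: one is a boundary, the other is [h] of a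
   boundary. *)
- apply/eqP; rewrite -subr_eq0 -cstB; apply/eqP.
  by rewrite psiphi cstD cst_res_diff cst_gmor cst_res_diff mul0mx addr0.
Qed.

(** Modulo the irrelevant ideal the comparison maps become degree-preserving scalar matrices with
    product the identity; exchanging the two resolutions gives the reverse inequality. *)
Lemma res_deg_unique M (C D : min_resolution M) i j :
  count_mem j (res_deg C i) = count_mem j (res_deg D i).
Proof.
suff le (C' D' : min_resolution M) :
    (count_mem j (res_deg C' i) <= count_mem j (res_deg D' i))%N.
  by apply/eqP; rewrite eqn_leq !le.
have [phi [psi [_ [_ _ _ psiphi]]]] := res_comparison C' D' i.
apply: (@count_mem_le_of_left_inverse k _ _ j (cmx phi) (cmx psi)); first exact: cmx_deg.
apply/row_matrixP => l; rewrite row_mul rowK -cst_gmor psiphi cst_gbasis.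
by rewrite rowE mulmx1.
Qed.

Lemma res_deg_perm M (C D : min_resolution M) i : perm_eq (res_deg C i) (res_deg D i).
Proof. by apply/allP => j _ /=; rewrite (res_deg_unique C D). Qed.

Lemma betti_count M (C : min_resolution M) i j : betti M i j = count_mem j (res_deg C i).
Proof.
rewrite /betti; case: (epsilon_spec (inhabits 0%N)
  (fun b => exists D : min_resolution M, b = count_mem j (res_deg D i))).
  by exists (count_mem j (res_deg C i)), C.
by move=> D ->; apply: res_deg_unique.
Qed.

(** A form of graded Nakayama: some homogeneous component of a bad syzygy would have a nonzero
    scalar as a coordinate, and could be solved for that generator, against irredundance. *)
Lemma min_gens_syz_cst M (d : seq int) (f : 'I_(size d) -> M) (hf : min_gens f)
    (c : gfree k n d) : gens_fun f c = 0 -> cst c = 0.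
Proof.
move=> c0; apply/rowP => i; rewrite [RHS]mxE; apply/eqP/negPn/negP => ci.
have cker : c \in lker_pred (gens_mor (min_gens_homog hf)) by apply/eqP.
have [s [e [_ he xE]]] := gr_sum (LkerElt cker : syzygies (min_gens_homog hf)).
have [p ep] : exists p, cst (lker_val (e p)) 0 i != 0.
  apply: NNPP => noe; move/negP: ci; apply; apply/eqP.
  rewrite -[c]/(lker_val (LkerElt cker)) xE raddf_sum /=.
  rewrite (big_morph _ (@cstD _ _ d) (@cst0 _ _ d)) summxE big1 // => p _.
  by apply/eqP/negPn/negP => ep; apply: noe; exists p.
set v := lker_val (e p) in ep; set a := cst v 0 i in ep.
have vgr : gr (gfree k n d) p v := he p.
have va := gfree_coord_const vgr (esym (cst_gr vgr ep)).
have v0 : gens_fun f v = 0 := lker_valP (e p).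
apply: (min_gens_irredundant hf (i := i)).
exists (fun j => - (a^-1)%:MP * (v : 'rV_(size d)) 0 j).
under eq_bigr do rewrite -scalerA.
rewrite -scaler_sumr; move: v0; rewrite /gens_fun (bigD1 i) //= va => /eqP.
rewrite addrC addr_eq0 => /eqP->; rewrite scaleNr scalerN opprK scalerA.
by rewrite -mpolyCM mulVf // scale1r.
Qed.

Definition gker_incl M (N : gmodule k n) (f : gmor M N) : gmor (gker f) M :=
  @GMor k n (gker f) M (@lker_val _ _ _ f) (fun p x hx => hx).

(** * Prepending minimal generators to a resolution of their syzygies *)

Section Extension.

Variables (M : gmodule k n) (d : seq int) (f : 'I_(size d) -> M) (hf : min_gens f).
Variable C : min_resolution (syzygies (min_gens_homog hf)).

Definition ext_deg i := if i is i'.+1 then res_deg C i' else d.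

Definition ext_diff i : gmor (gfree k n (ext_deg i.+1)) (gfree k n (ext_deg i)) :=
  if i is i'.+1 then res_diff C i' else gmor_comp (gker_incl _) (res_aug C).

Lemma min_gens_surj : surj (gens_mor (min_gens_homog hf)).
Proof.
move=> x; have [c ->] := min_gens_span hf x; exists (\row_i c i).
by rewrite /= /gens_fun; apply: eq_bigr => i _; rewrite mxE.
Qed.

Lemma min_resolution_ext : exists C' : min_resolution M,
  res_deg C' 0%N = d /\ forall i, res_deg C' i.+1 = res_deg C i.
Proof.
have exact0 x : gens_mor (min_gens_homog hf) x = 0 <-> exists y, ext_diff 0 y = x.
  split=> [x0|[y <-]]; last exact: lker_valP.
  have xker : x \in lker_pred (gens_mor (min_gens_homog hf)) by apply/eqP.
  have [y yE] := @res_aug_surj _ _ _ C (LkerElt xker).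
  by exists y; rewrite /= yE.
have exactS i x : ext_diff i x = 0 <-> exists y, ext_diff i.+1 y = x.
  case: i x => [|i] x; last exact: res_exactS.
  split=> [x0|[y <-]]; first by apply/res_exact0; apply: val_inj.
  rewrite /= (_ : res_aug C _ = 0) ?linear0 //.
  by apply/res_exact0; exists y.
have minimal i y (j : 'I_(size (ext_deg i))) :
    ((ext_diff i y : 'rV_(size (ext_deg i))) 0 j)@_0%MM = 0.
  case: i y j => [|i] y j; last exact: res_minimal.
  have := min_gens_syz_cst hf (lker_valP (res_aug C y)).
  by move=> /rowP/(_ j); rewrite !mxE.
by exists (MinResolution min_gens_surj exact0 exactS minimal).
Qed.

End Extension.

(** * Existence of minimal resolutions by iterated syzygies *)

Record min_gens_state := MinGensState {
  st_mod : gmodule k n;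
  st_deg : seq int;
  st_gen : 'I_(size st_deg) -> st_mod;
  st_min : min_gens st_gen
}.

Definition st_syz (S : min_gens_state) := syzygies (min_gens_homog (st_min S)).

Lemma st_next_ex (S : min_gens_state) :
  exists p : {d : seq int & 'I_(size d) -> st_syz S}, min_gens (projT2 p).
Proof.
have [d [g hg]] := fin_gen_min_gens (fin_gen_gker (gens_mor (min_gens_homog (st_min S)))).
by exists (existT _ d g).
Qed.

(** Minimal generators of the syzygies are only known to exist; choosing them makes the step a
    function that can be iterated. *)
Definition st_next (S : min_gens_state) : min_gens_state :=
  let p := constructive_indefinite_description _ (st_next_ex S) in
  MinGensState (proj2_sig p).

Lemma min_resolution_of_min_gens M (d : seq int) (f : 'I_(size d) -> M) :
  min_gens f -> exists C : min_resolution M, res_deg C 0%N = d.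
Proof.
move=> hf; pose st i := iter i st_next (MinGensState hf).
pose bound i := gens_mor (min_gens_homog (st_min (st i))).
(* The free cover of the next syzygy module, followed by its inclusion. *)
pose diff i : gmor (gfree k n (st_deg (st i.+1))) (gfree k n (st_deg (st i))) :=
  gmor_comp (gker_incl (bound i)) (bound i.+1).
have bound_surj i : surj (bound i) by apply: min_gens_surj.
have exact0 i x : bound i x = 0 <-> exists y, diff i y = x.
  split=> [x0|[y <-]]; last exact: lker_valP.
  have xker : x \in lker_pred (bound i) by apply/eqP.
  have [y yE] := bound_surj i.+1 (LkerElt xker).
  by exists y; rewrite /= yE.
have exactS i x : diff i x = 0 <-> exists y, diff i.+1 y = x.
  rewrite -exact0; split=> [x0|x0]; first exact: val_inj.
  by rewrite /= x0 linear0.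
have minimal i y (j : 'I_(size (st_deg (st i)))) :
    ((diff i y : 'rV_(size (st_deg (st i)))) 0 j)@_0%MM = 0.
  have := min_gens_syz_cst (st_min (st i)) (lker_valP (bound i.+1 y)).
  by move=> /rowP/(_ j); rewrite !mxE.
by exists (@MinResolution _ _ _ (fun i => st_deg (st i)) (bound 0%N) diff
   (bound_surj 0%N) (exact0 0%N) exactS minimal).
Qed.

Lemma min_resolution_of_min_gens2 M (d : seq int) (f : 'I_(size d) -> M)
    (hf : min_gens f) (d' : seq int)
    (g : 'I_(size d') -> syzygies (min_gens_homog hf)) : min_gens g ->
  exists C : min_resolution M, res_deg C 0%N = d /\ res_deg C 1%N = d'.
Proof.
move=> /min_resolution_of_min_gens[C <-].
by have [C' [C'0 C'S]] := min_resolution_ext C; exists C'; rewrite C'0 C'S.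
Qed.

End Resolutions.

(** * Degrees of generators and of syzygies, independently of choices *)

Section DegreesOfGenerators.

Variables (k : fieldType) (n : nat) (M : gmodule k n).

(** Every minimal system of generators starts a minimal resolution, and all of these have the same
    degrees, so one system decides for all. *)
Lemma generated_in_degrees_of_min_gens (D d : seq int) (f : 'I_(size d) -> M) :
  min_gens f -> {subset d <= D} -> generated_in_degrees M D.
Proof.
move=> hf dD; split; first by exists d, f.
move=> d' f' hf'.
have [C <-] := min_resolution_of_min_gens hf'.
have [C' C'0] := min_resolution_of_min_gens hf.
by move=> p; rewrite (perm_mem (res_deg_perm C C' 0)) C'0; apply: dD.
Qed.

Lemma syzygies_generated_of_resolution (C : min_resolution M) (D : seq int) :
  {subset res_deg C 1%N <= D} -> syzygies_generated_in_degrees M D.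
Proof.
move=> CD d f hf; split; first exact/fin_gen_min_gens/fin_gen_gker.
move=> d' g hg; have [C' [_ C'1]] := min_resolution_of_min_gens2 hg.
by move=> p; rewrite -C'1 (perm_mem (res_deg_perm C' C 1)); apply: CD.
Qed.

(** Converse of [min_gens_syz_cst]: expressing [f i] by the other generators would give a syzygy
    with [i]-th coordinate 1. *)
Lemma min_gens_of_cst (d : seq int) (f : 'I_(size d) -> M) :
  (forall i : 'I_(size d), gr M d`_i (f i)) ->
  (forall x, exists v : gfree k n d, x = gens_fun f v) ->
  (forall v : gfree k n d, gens_fun f v = 0 -> cst v = 0) -> min_gens f.
Proof.
move=> hom spn cst_eq0; split=> // [x|i [c fi]].
  by have [v ->] := spn x; exists (fun i => (v : 'rV_(size d)) 0 i).
pose v : gfree k n d := gbasis i - (\row_j (if j == i then 0 else c j) : 'rV_(size d)).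
have /cst_eq0/rowP/(_ i) : gens_fun f v = 0.
  rewrite /gens_fun; under eq_bigr do rewrite !mxE eqxx /= scalerBl.
  rewrite sumrB (bigD1 i) //= eqxx scale1r big1 => [|j /negPf ji]; last first.
    by rewrite ji scale0r.
  apply/eqP; rewrite addr0 subr_eq0 fi big_mkcond; apply/eqP/eq_bigr => j _.
  by case: (j == i); rewrite ?scale0r.
by rewrite cstB !mxE !eqxx /= mcoeff1 mcoeff0 eqxx subr0 => /eqP; rewrite oner_eq0.
Qed.

End DegreesOfGenerators.

(** * Scalar matrices *)

Section ConstantMorphisms.

Variables (k : fieldType) (n : nat).

Lemma const_gmor (d d' : seq int) p (A : 'M[k]_(size d, size d')) :
  all (pred1 p) d -> all (pred1 p) d' ->
  exists f : gmor (gfree k n d) (gfree k n d'),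
    forall v, f v = (v : 'rV_(size d)) *m map_mx (@mpolyC n k) A :> 'rV_(size d').
Proof.
move=> dp dp'.
have hA (i : 'I_(size d)) :
    gr (gfree k n d') d`_i (row i (map_mx (@mpolyC n k) A)).
  have -> : d`_i = p by apply/eqP/(allP dp)/mem_nth.
  by rewrite -map_row; apply: gr_const.
by exists (gens_mor hA) => v; rewrite mulmx_sum_row.
Qed.

(** [io] embeds a free module as the kernel of [f], and [pi] is a retraction onto it. *)
Definition kernel_splitting (d d' r : seq int) (f : gmor (gfree k n d) (gfree k n d'))
    (io : gmor (gfree k n r) (gfree k n d)) (pi : gmor (gfree k n d) (gfree k n r)) :=
  [/\ forall v, pi (io v) = v, forall v, f (io v) = 0
    & forall v, f v = 0 -> io (pi v) = v].

(** With all generators in the one degree [p], [f] is a scalar matrix [A], and the hypothesis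
    supplies [S] with [S *m A = 1]; what remains is linear algebra over [k]. *)
Lemma const_kernel_splitting (d d' : seq int) p (f : gmor (gfree k n d) (gfree k n d')) :
  all (pred1 p) d -> all (pred1 p) d' ->
  (forall j, exists u, cst (f u) = delta_mx 0 j) ->
  surj f /\ exists (r : seq int) (io : gmor (gfree k n r) (gfree k n d))
    (pi : gmor (gfree k n d) (gfree k n r)),
    [/\ all (pred1 p) r, size d = (size d' + size r)%N & kernel_splitting f io pi].
Proof.
move=> dp dp' /fin_all_exists[u hu].
pose A := cmx f; pose S := \matrix_j cst (u j).
have SA : S *m A = 1%:M.
  by apply/row_matrixP => j; rewrite row_mul rowK -cst_gmor hu rowE mulmx1.
have fE v := gmor_const f v dp dp'.
split=> [y|].
  exists ((y : 'rV_(size d')) *m map_mx (@mpolyC n k) S).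
  by rewrite fE -mulmxA -map_mxM SA map_mx1 mulmx1.
(* Vectors being rows, [P] projects onto the kernel of [A]; its rank factorization will give [io]
   and [pi]. *)
pose P := 1%:M - A *m S.
have PA : P *m A = 0 by rewrite mulmxBl mul1mx -mulmxA SA mulmx1 subrr.
have PP : P *m P = P by rewrite {2}/P mulmxBr mulmx1 mulmxA PA mul0mx subr0.
have rA : \rank A = size d'.
  by apply/eqP; rewrite eqn_leq rank_leq_col -{1}(mxrank1 k (size d')) -SA mxrankM_maxr.
have rP : \rank P = (size d - size d')%N.
  apply/eqP; rewrite eqn_leq; apply/andP; split.
    by rewrite -rA -mxrank_ker; apply/mxrankS/sub_kermxP.
  rewrite leq_subLR -{1}(mxrank1 k (size d)) -(subrK (A *m S) 1%:M) addrC.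
  apply: leq_trans (mxrank_add _ _) _; rewrite leq_add2r.
  by rewrite -{2}rA mxrankM_maxl.
have d'd : (size d' <= size d)%N by rewrite -rA rank_leq_row.
(* Idempotence of [P], after cancelling the full-rank factors. *)
have BY : row_base P *m col_base P = 1%:M.
  apply: (row_free_inj (row_base_free P)); apply: (row_full_inj (col_base_full P)).
  rewrite mul1mx mulmx_base -mulmxA mulmx_base.
  by rewrite mulmxA mulmx_base PP.
have [r [rp sr]] : exists r : seq int, all (pred1 p) r /\ \rank P = size r.
  by exists (nseq (\rank P) p); rewrite size_nseq all_nseq /= eqxx orbT.
move: (row_base P) (col_base P) BY (mulmx_base P); rewrite sr => B Y BY YB.
have [io ioE] := const_gmor B rp dp; have [pi piE] := const_gmor Y dp rp.
exists r, io, pi; split=> //; first by rewrite -sr rP subnKC.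
have BA : B *m A = 0.
  by rewrite -[B]mul1mx -BY -[B *m Y *m B]mulmxA YB -mulmxA PA mulmx0.
split=> v.
- by rewrite piE ioE -mulmxA -map_mxM BY map_mx1 mulmx1.
- by rewrite fE ioE -mulmxA -map_mxM BA map_mx0 mulmx0.
- rewrite fE ioE piE => fv0; rewrite -mulmxA -map_mxM YB map_mxB map_mx1 map_mxM.
  by rewrite mulmxBr mulmx1 mulmxA fv0 mul0mx subr0.
Qed.

Lemma kernel_splitting_cst (d d' r : seq int) (f : gmor (gfree k n d) (gfree k n d'))
    (io : gmor (gfree k n r) (gfree k n d)) (pi : gmor (gfree k n d) (gfree k n r)) v :
  kernel_splitting f io pi -> cst (io v) = 0 -> cst v = 0.
Proof. by move=> [pio _ _] iov; rewrite -(pio v) cst_gmor iov mul0mx. Qed.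

End ConstantMorphisms.

(** * The kernel of a surjection *)

Section KernelOfSurjection.

Variables (k : fieldType) (n : nat) (m : int) (E G : gmodule k n).
Variables (resE : min_resolution E) (resG : min_resolution G).
Variables (mu : gmor E G) (hmu : surj mu) (mui : lifting mu resE resG).

Hypothesis dE0 : all (pred1 m) (res_deg resE 0%N).
Hypothesis dG0 : all (pred1 m) (res_deg resG 0%N).
Hypothesis dG1 : all (pred1 (m + 1)) (res_deg resG 1%N).
Hypothesis dG2 : all (pred1 (m + 2)) (res_deg resG 2%N).

Local Notation F := (gker mu).
Local Notation e0 := (res_aug resE).
Local Notation e1 := (res_diff resE 0%N).
Local Notation e2 := (res_diff resE 1%N).
Local Notation g0 := (res_aug resG).
Local Notation g1 := (res_diff resG 0%N).
Local Notation g2 := (res_diff resG 1%N).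

(** The basis vector differs from a value of [mu^0] by a boundary, which reduces to zero by
    minimality. *)
Lemma lift0_cst_surj j : exists u, cst (mui 0%N u) = delta_mx 0 j.
Proof.
have [x muxE] := hmu (g0 (gbasis j)); have [u ux] := @res_aug_surj _ _ _ resE x.
exists u; have [z zE] : exists z, g1 z = gbasis j - mui 0%N u.
  by apply/res_exact0; rewrite linearB lift_aug ux muxE subrr.
rewrite -(@cst_gbasis k n); apply/esym/eqP; rewrite -subr_eq0 -cstB -zE.
by rewrite cst_res_diff.
Qed.

Lemma e0_e1 w : e0 (e1 w) = 0.
Proof. by apply/res_exact0; exists w. Qed.

Lemma e0_ker u v : mui 0%N u = g1 v -> e0 u \in lker_pred mu.
Proof.
move=> uv; apply/eqP; rewrite -(lift_aug mui) uv.
by apply/res_exact0; exists v.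
Qed.

Lemma ker_lift (x : F) : exists u v, lker_val x = e0 u /\ mui 0%N u = g1 v.
Proof.
have [u ux] := @res_aug_surj _ _ _ resE (lker_val x).
have [v vE] : exists v, g1 v = mui 0%N u.
  by apply/res_exact0; rewrite lift_aug ux; apply: lker_valP.
by exists u, v.
Qed.

(** * Generators of [F] *)

Section Generators.

Variables (r0 : seq int).
Variables (io0 : gmor (gfree k n r0) (res_term resE 0%N)).
Variables (pi0 : gmor (res_term resE 0%N) (gfree k n r0)).
Hypothesis r0m : all (pred1 m) r0.
Hypothesis split0 : kernel_splitting (mui 0%N) io0 pi0.

Lemma io0_ker v : e0 (io0 v) \in lker_pred mu.
Proof. by apply: (@e0_ker _ 0); case: split0 => _ -> _; rewrite linear0. Qed.

Definition kgen (i : 'I_(size r0)) : F := LkerElt (io0_ker (gbasis i)).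

Lemma kgen_gr i : gr F m (kgen i).
Proof.
apply: (gmorP e0); apply: gmorP.
have <- : r0`_i = m by apply/eqP/(allP r0m)/mem_nth.
exact: gbasis_gr.
Qed.

Lemma kgen_gr_nth (i : 'I_(size r0)) : gr F r0`_i (kgen i).
Proof. by rewrite (eqP (allP r0m _ (mem_nth 0 (ltn_ord i)))); apply: kgen_gr. Qed.

Lemma kgen_val v : lker_val (gens_fun kgen v) = e0 (io0 v).
Proof.
rewrite /gens_fun raddf_sum [RHS](gmor_basis (gmor_comp e0 io0)).
by apply: eq_bigr.
Qed.

(** A relation makes [io0 v] a boundary of [resE], which has no constant part by minimality; the
    retraction passes this on to [v]. *)
Lemma kgen_cst v : gens_fun kgen v = 0 -> cst v = 0.
Proof.
move=> v0; apply: (kernel_splitting_cst split0).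
have [y <-] : exists y, e1 y = io0 v; last exact: cst_res_diff.
by apply/res_exact0; rewrite -kgen_val v0.
Qed.

Lemma ker_generated : generated_in_degrees F [:: m; m + 1].
Proof.
have [surj0 _] := const_kernel_splitting dE0 dG0 lift0_cst_surj.
(* Homogeneous lifts through [mu^0] of the values of [g1] on the basis: they supply the generators
   of degree [m + 1]. *)
have /fin_all_exists2[u ugr uE] (l : 'I_(size (res_deg resG 1%N))) :
    exists2 u, gr (res_term resE 0%N) (m + 1) u & mui 0%N u = g1 (gbasis l).
  have [u0 u0E] := surj0 (g1 (gbasis l)).
  rewrite -u0E; apply: gr_lift; rewrite u0E; apply: gmorP.
  have <- : (res_deg resG 1)`_l = m + 1 by apply/eqP/(allP dG1)/mem_nth.
  exact: gbasis_gr.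
pose ugen l : F := LkerElt (e0_ker (uE l)).
pose gen (i : 'I_(size r0) + 'I_(size (res_deg resG 1))) : F :=
  match i with inl i => kgen i | inr l => ugen l end.
pose deg (i : 'I_(size r0) + 'I_(size (res_deg resG 1))) :=
  if i is inl _ then m else m + 1.
have [i|x|d [f [hf dD]]] := @min_gens_of_family _ _ F _ deg gen.
- by case: i => [i|l]; [exact: kgen_gr|exact: (gmorP e0)].
- have [w [v [xE wv]]] := ker_lift x.
  pose w' := \sum_l (v : 'rV_(size (res_deg resG 1))) 0 l *: u l.
  (* [w - w'] lies in the kernel of [mu^0], hence equals [io0 c]. *)
  pose c := pi0 (w - w').
  exists (fun i => match i with
    | inl i => (c : 'rV_(size r0)) 0 i
    | inr l => (v : 'rV_(size (res_deg resG 1))) 0 l end).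
  rewrite big_sumType /= -[X in X + _]/(gens_fun kgen c).
  apply: val_inj; rewrite [LHS]/= raddfD /= kgen_val raddf_sum /=.
  have [_ _ ->] := split0.
    rewrite linearB xE /= linear_sum.
    by under [X in _ - X]eq_bigr do rewrite linearZZ; rewrite subrK.
  rewrite linearB wv linear_sum gmor_basis -sumrB big1 // => l _.
  by rewrite linearZZ uE subrr.
- apply: (generated_in_degrees_of_min_gens hf) => p /dD /codomP[[i|l] ->].
    by rewrite inE eqxx.
  by rewrite !inE eqxx orbT.
Qed.

(** * The case of a surjective [mu^1]: minimal generators and syzygies of [F] *)

Section Surjective1.

Hypothesis surj1 : surj (mui 1%N).

Lemma kgen_min_gens : min_gens kgen.
Proof.
apply: min_gens_of_cst => [i|x|]; [exact: kgen_gr_nth| |exact: kgen_cst].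
have [u [v [xE uv]]] := ker_lift x; have [w wv] := surj1 v.
(* Subtracting [e1 w] keeps the image under [e0] and moves [u] into the kernel of [mu^0]. *)
exists (pi0 (u - e1 w)); apply: val_inj; rewrite [RHS]kgen_val.
have [_ _ ->] := split0; first by rewrite linearB e0_e1 subr0.
by rewrite linearB uv -wv lift_diff subrr.
Qed.

Local Notation Z := (syzygies (min_gens_homog kgen_min_gens)).

Lemma syz_ker w v : mui 1%N w = g2 v ->
  pi0 (e1 w) \in lker_pred (gens_mor (min_gens_homog kgen_min_gens)).
Proof.
move=> wv; apply/eqP/val_inj; rewrite [LHS]kgen_val.
have [_ _ ->] := split0; first exact: e0_e1.
by rewrite -lift_diff wv res_diffK.
Qed.

(** The syzygies now relate to [mu^1] and [g2] as [F] did to [mu^0] and [g1], so the generation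
    argument repeats one step higher. *)
Lemma syz_lift (x : Z) :
  exists w v, [/\ lker_val x = pi0 (e1 w), mui 1%N w = g2 v & io0 (lker_val x) = e1 w].
Proof.
have [w wE] : exists w, e1 w = io0 (lker_val x).
  apply/res_exact0; rewrite -kgen_val.
  by have /= -> := lker_valP x.
have [v vE] : exists v, g2 v = mui 1%N w.
  apply/res_exactS; rewrite lift_diff wE.
  by case: split0 => _ -> _.
exists w, v; split=> //; rewrite wE.
by case: split0 => ->.
Qed.

Section SyzygyGenerators.

Variables (r1 : seq int).
Variables (io1 : gmor (gfree k n r1) (res_term resE 1%N)).
Variables (pi1 : gmor (res_term resE 1%N) (gfree k n r1)).
Hypothesis r1m : all (pred1 (m + 1)) r1.
Hypothesis split1 : kernel_splitting (mui 1%N) io1 pi1.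

Lemma io1_ker v :
  pi0 (e1 (io1 v)) \in lker_pred (gens_mor (min_gens_homog kgen_min_gens)).
Proof. by apply: (@syz_ker _ 0); case: split1 => _ -> _; rewrite linear0. Qed.

Definition sgen (i : 'I_(size r1)) : Z := LkerElt (io1_ker (gbasis i)).

Lemma sgen_gr i : gr Z (m + 1) (sgen i).
Proof.
apply: (gmorP pi0); apply: gmorP; apply: gmorP.
have <- : r1`_i = m + 1 by apply/eqP/(allP r1m)/mem_nth.
exact: gbasis_gr.
Qed.

Lemma sgen_gr_nth (i : 'I_(size r1)) : gr Z r1`_i (sgen i).
Proof. by rewrite (eqP (allP r1m _ (mem_nth 0 (ltn_ord i)))); apply: sgen_gr. Qed.

Lemma sgen_val v : lker_val (gens_fun sgen v) = pi0 (e1 (io1 v)).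
Proof.
transitivity (gmor_comp pi0 (gmor_comp e1 io1) v) => //.
by rewrite [RHS]gmor_basis /gens_fun raddf_sum; apply: eq_bigr.
Qed.

(** [e1 (io1 v)] lies in the kernel of [mu^0], where [pi0] is injective; a relation thus makes
    [io1 v] a cycle, hence a boundary, with no constant part. *)
Lemma sgen_cst v : gens_fun sgen v = 0 -> cst v = 0.
Proof.
move=> v0; apply: (kernel_splitting_cst split1).
have [y <-] : exists y, e2 y = io1 v; last exact: cst_res_diff.
apply/res_exactS; have [_ _ piK] := split0; rewrite -[LHS]piK.
  by rewrite -sgen_val v0 /= linear0.
by rewrite -lift_diff; case: split1 => _ -> _; rewrite linear0.
Qed.

Lemma syz_family : exists (d : seq int) (f : 'I_(size d) -> Z),
  min_gens f /\ {subset d <= [:: m + 1; m + 2]}.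
Proof.
(* Lifts through [mu^1] of the values of [g2] on the basis: the source of the quadratic syzygies. *)
have /fin_all_exists2[u ugr uE] (l : 'I_(size (res_deg resG 2%N))) :
    exists2 u, gr (res_term resE 1%N) (m + 2) u & mui 1%N u = g2 (gbasis l).
  have [u0 u0E] := surj1 (g2 (gbasis l)).
  rewrite -u0E; apply: gr_lift; rewrite u0E; apply: gmorP.
  have <- : (res_deg resG 2)`_l = m + 2 by apply/eqP/(allP dG2)/mem_nth.
  exact: gbasis_gr.
pose ugen l : Z := LkerElt (syz_ker (uE l)).
pose gen (i : 'I_(size r1) + 'I_(size (res_deg resG 2))) : Z :=
  match i with inl i => sgen i | inr l => ugen l end.
pose deg (i : 'I_(size r1) + 'I_(size (res_deg resG 2))) :=
  if i is inl _ then m + 1 else m + 2.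
have [i|x|d [f [hf dD]]] := @min_gens_of_family _ _ Z _ deg gen.
- case: i => [i|l]; first exact: sgen_gr.
  by apply: (gmorP pi0); apply: gmorP.
- have [w [v [xE wv _]]] := syz_lift x.
  pose w' := \sum_l (v : 'rV_(size (res_deg resG 2))) 0 l *: u l.
  pose c := pi1 (w - w').
  exists (fun i => match i with
    | inl i => (c : 'rV_(size r1)) 0 i
    | inr l => (v : 'rV_(size (res_deg resG 2))) 0 l end).
  rewrite big_sumType /= -[X in X + _]/(gens_fun sgen c).
  apply: val_inj; rewrite [LHS]/= raddfD /= sgen_val raddf_sum /=.
  have [_ _ ->] := split1.
    rewrite xE !linearB /= [X in _ - X](_ : _ =
      \sum_l (v : 'rV_(size (res_deg resG 2))) 0 l *: pi0 (e1 (u l))).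
      by rewrite subrK.
    by rewrite !linear_sum; apply: eq_bigr => l _; rewrite !linearZZ.
  rewrite linearB wv linear_sum gmor_basis -sumrB big1 // => l _.
  by rewrite linearZZ uE subrr.
- exists d, f; split=> // p /dD /codomP[[i|l] ->].
    by rewrite inE eqxx.
  by rewrite !inE eqxx orbT.
Qed.

Lemma sgen_min_gens : surj (mui 2%N) -> min_gens sgen.
Proof.
move=> surj2; apply: min_gens_of_cst => [i|x|]; [exact: sgen_gr_nth| |exact: sgen_cst].
have [w [v [xE wv _]]] := syz_lift x; have [z zv] := surj2 v.
(* Subtracting the boundary [e2 z] keeps the image under [e1] and moves [w] into the kernel of
   [mu^1]. *)
exists (pi1 (w - e2 z)); apply: val_inj; rewrite [RHS]sgen_val.
have [_ _ ->] := split1; first by rewrite linearB res_diffK subr0.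
by rewrite linearB wv -zv lift_diff subrr.
Qed.

End SyzygyGenerators.

End Surjective1.

End Generators.

End KernelOfSurjection.

Theorem theorem1p1 (k : closedFieldType) (hk : 2%N \notin [pchar k])
    (n : nat) (m : int) (E G : gmodule k n.+1)
    (hE : fin_gen E) (hG : fin_gen G)
    (hE1 : linearly_presented E m 1) (hG2 : linearly_presented G m 2)
    (resE : min_resolution E) (resG : min_resolution G)
    (mu : gmor E G) (hmu : surj mu) (mui : lifting mu resE resG) :
  let F := gker mu in
  [/\ generated_in_degrees F [:: m; m + 1],
      surj (mui 1%N) ->
        [/\ generated_in_degrees F [:: m],
            syzygies_generated_in_degrees F [:: m + 1; m + 2] &
            (betti F 0 m)%:Z = (betti E 0 m)%:Z - (betti G 0 m)%:Z]
    & surj (mui 1%N) -> surj (mui 2%N) ->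
        linearly_presented F m 1 /\
        (betti F 1 (m + 1))%:Z = (betti E 1 (m + 1))%:Z - (betti G 1 (m + 1))%:Z].
Proof.
move=> F; clear hk hE hG.
(* [linearly_presented] provides some resolution; uniqueness of degrees transfers its linear shape
   to the given ones. *)
have deg_lin (M : gmodule k n.+1) l (C : min_resolution M) i :
    linearly_presented M m l -> (i <= l)%N -> all (pred1 (m + i%:Z)) (res_deg C i).
  by move=> [D hD] il; rewrite (perm_all _ (res_deg_perm C D i)) hD.
have dE0 := deg_lin _ _ resE 0%N hE1 isT; rewrite addr0 in dE0.
have dE1 := deg_lin _ _ resE 1%N hE1 isT.
have dG0 := deg_lin _ _ resG 0%N hG2 isT; rewrite addr0 in dG0.
have dG1 := deg_lin _ _ resG 1%N hG2 isT.
have dG2 := deg_lin _ _ resG 2%N hG2 isT.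
have [_ [r0 [io0 [pi0 [r0m sz0 split0]]]]] :=
  const_kernel_splitting dE0 dG0 (lift0_cst_surj hmu mui).
have splitting1 : surj (mui 1%N) ->
    exists (r : seq int) (io : gmor (gfree k n.+1 r) (res_term resE 1%N))
      (pi : gmor (res_term resE 1%N) (gfree k n.+1 r)),
    [/\ all (pred1 (m + 1)) r,
        size (res_deg resE 1%N) = (size (res_deg resG 1%N) + size r)%N
      & kernel_splitting (mui 1%N) io pi].
  move=> surj1; have [|//] := const_kernel_splitting (f := mui 1%N) dE1 dG1.
  by move=> j; have [u uE] := surj1 (gbasis j); exists u; rewrite uE cst_gbasis.
have count_all p (d : seq int) : all (pred1 p) d -> count_mem p d = size d.
  by rewrite all_count => /eqP.
split; first exact: (ker_generated hmu dE0 dG0 dG1 r0m split0).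
  move=> surj1; have hf := kgen_min_gens r0m split0 surj1.
  have [r1 [io1 [pi1 [r1m _ split1]]]] := splitting1 surj1.
  split.
  - by apply: (generated_in_degrees_of_min_gens hf) => p /(allP r0m) /eqP->; rewrite inE.
  - have [d [f [hf' dD]]] := syz_family dG2 r0m split0 surj1 r1m split1.
    have [C [_ C1]] := min_resolution_of_min_gens2 hf'.
    by apply: (@syzygies_generated_of_resolution _ _ _ C); rewrite C1.
  - have [C C0] := min_resolution_of_min_gens hf.
    (* Each term involved lives in a single degree, so Betti numbers are sizes, and [sz0] relates
       these. *)
    rewrite (betti_count C) (betti_count resE) (betti_count resG) C0 !count_all //.
    by rewrite sz0 PoszD addrAC subrr add0r.
move=> surj1 surj2.
have [r1 [io1 [pi1 [r1m sz1 split1]]]] := splitting1 surj1.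
(* [kgen] and [sgen] give the first two terms of a resolution of [F], with degrees [r0] and [r1]. *)
have [C [C0 C1]] := min_resolution_of_min_gens2
  (sgen_min_gens r0m split0 surj1 r1m split1 surj2).
split; first by exists C => -[|[|//]] _; rewrite ?C0 ?C1 ?addr0.
rewrite (betti_count C) (betti_count resE) (betti_count resG) C1 !count_all //.
by rewrite sz1 PoszD addrAC subrr add0r.
Qed.
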